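(* There exists a constant $0<\gamma<1$ such that for every $n$ there is a non-malleable two-source extractor $\mathrm{nmExt}:\{0,1\}^n\times\{0,1\}^n\to\{0,1\}^m$ for $(n,(1-\gamma)n)$-sources with error $2^{-\Omega(n\log\log n/\log n)}$ and output length $m=\Omega(n)$.
   Context: An $(n,k)$-source is a random variable on $\{0,1\}^n$ with min-entropy $H_\infty(X)=\min_x\log(1/\Pr[X=x])\ge k$. A function $\mathrm{nmExt}:\{0,1\}^n\times\{0,1\}^n\to\{0,1\}^m$ is a $(k,\varepsilon)$ non-malleable two-source extractor if for any two independent $(n,k)$-sources $X_1,X_2$ and any functions $f_1,f_2:\{0,1\}^n\to\{0,1\}^n$ such that at least one of $f_1,f_2$ has no fixed points, the distribution $(\mathrm{nmExt}(X_1,X_2),\mathrm{nmExt}(f_1(X_1),f_2(X_2)))$ is $\varepsilon$-close in statistical distance to $(U_m,\mathrm{nmExt}(f_1(X_1),f_2(X_2)))$, where $U_m$ is uniform on $\{0,1\}^m$ and independent of $(X_1,X_2)$. Logarithms are base 2. *)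

(* Defs.v *)
From HB Require Import structures.
From mathcomp Require Import all_boot all_order all_algebra.
From mathcomp Require Import all_classical all_reals all_analysis.

Set Implicit Arguments.
Unset Strict Implicit.
Unset Printing Implicit Defensive.

Import Order.TTheory GRing.Theory Num.Theory.
Import numFieldNormedType.Exports.

Local Open Scope classical_set_scope.
Local Open Scope ring_scope.

(* The product sigma-algebra on bits n is the discrete one. *)
Notation bits n := (n.-tuple bool).

Definition log2 (R : realType) (x : R) : R := ln x / ln 2.

Section FiniteValued.
Context (d : measure_display) (T : measurableType d) (R : realType)
  (P : probability T R).

Definition prob_eq (A : finType) (X : T -> A) (a : A) : R :=
  fine (P (X @^-1` [set a])).

(* Points of probability 0 contribute log (1 / 0) = +oo to the minimum;
   they need a separate case because 0^-1 = 0 in R. *)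
Definition min_entropy (A : finType) (X : T -> A) : \bar R :=
  \big[Order.min/+oo%E]_(a : A)
    (if prob_eq X a == 0 then +oo%E else (log2 (prob_eq X a)^-1)%:E).

Definition independent (A B : finType) (X : T -> A) (Y : T -> B) : Prop :=
  forall (a : A) (b : B),
    prob_eq (fun t => (X t, Y t)) (a, b) = prob_eq X a * prob_eq Y b.

Definition uniform (A : finType) (X : T -> A) : Prop :=
  forall a : A, prob_eq X a = (#|A|%:R)^-1.

Definition stat_dist (A : finType) (X Y : T -> A) : R :=
  2^-1 * \sum_(a : A) `|prob_eq X a - prob_eq Y a|.

Definition is_source (n : nat) (k : R) (X : T -> bits n) : Prop :=
  (k%:E <= min_entropy X)%E.

End FiniteValued.

Definition no_fixed_point (A : Type) (f : A -> A) : Prop :=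
  forall x : A, f x <> x.

Definition nm_two_source_extractor (R : realType) (n m : nat) (k eps : R)
    (nmExt : bits n -> bits n -> bits m) : Prop :=
  forall (d : measure_display) (T : measurableType d) (P : probability T R)
    (X1 X2 : {RV P >-> bits n}) (U : {RV P >-> bits m})
    (f1 f2 : bits n -> bits n),
  is_source P k X1 -> is_source P k X2 -> independent P X1 X2 ->
  uniform P U -> independent P U (fun t => (X1 t, X2 t)) ->
  no_fixed_point f1 \/ no_fixed_point f2 ->
  stat_dist P
    (fun t => (nmExt (X1 t) (X2 t), nmExt (f1 (X1 t)) (f2 (X2 t))))
    (fun t => (U t, nmExt (f1 (X1 t)) (f2 (X2 t)))) <= eps.

(* f = Omega(g) without absolute values: with the norms used by =Omega_\oo,
   a large negative f would qualify. *)
Definition isOmega (R : realType) (f g : nat -> R) : Prop :=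
  exists2 c : R, 0 < c & \forall n \near \oo, c * g n <= f n.

(* Main.v *)
Require Import Defs.
From HB Require Import structures.
From mathcomp Require Import all_boot all_order all_algebra.
From mathcomp Require Import all_classical all_reals all_analysis.
From mathcomp Require Import ring lra zify.

Import Order.TTheory GRing.Theory Num.Theory.
Import numFieldNormedType.Exports.

Local Open Scope classical_set_scope.
Local Open Scope ring_scope.

(** A uniformly random function E works.  Fix tampering functions f1, f2, sets
    S, T of inputs such that (f1, f2) maps S x T off itself, and a table of
    signs on pairs of outputs.  The signs, recentred in the first argument, sum
    over S x T to a sum Z of terms that can be resampled one at a time, so
    E[exp(l Z)] <= exp(8 l^2 N^2) with N = 2^n.  There are only 2^(O(n N)) such
    configurations, so some E makes Z = N^(2 - Omega(1)) in all of them at once.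

    The statistical distance is a bilinear form in the two source
    distributions, whose weights are at most 2^-k.  A fixed-point-free f_i has a
    colouring with 2n colours such that f_i changes every colour; on each colour
    class the form is at most 4^-k times its value at a vertex of the cube,
    which is one of the sums Z. *)

(** * Exponential moments under a uniformly random function *)

Section ExponentialMoment.
Context (R : realType) (D B : finType).
Implicit Types (E : {ffun D -> B}) (z : D) (a b : B).

Definition resample E z a : {ffun D -> B} :=
  [ffun w => if w == z then a else E w].

(** The map [(E, a) |-> (resample E z a, E z)] is an involution on pairs, so reindexing by it undoes
    the resampling. *)
Lemma sum_resample z (F : {ffun D -> B} -> R) :
  \sum_E \sum_a F (resample E z a) = #|B|%:R * \sum_E F E.
Proof.
rewrite pair_big /= (reindex_inj (h := fun p : {ffun D -> B} * B =>
  (resample p.1 z p.2, p.1 z))) /=; last first.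
  apply: (inv_inj (f := fun p : {ffun D -> B} * B =>
    (resample p.1 z p.2, p.1 z))) => -[E a] /=.
  by rewrite /resample ffunE eqxx; congr (_, _); apply/ffunP => w;
    rewrite !ffunE; case: eqP => // ->.
rewrite -(pair_big xpredT xpredT (fun E a =>
  F (resample (resample E z a) z (E z)))) /=.
rewrite mulr_sumr; apply: eq_bigr => E _.
rewrite (eq_bigr (fun=> F E)) ?sumr_const ?mulr_natl // => a _.
by congr F; apply/ffunP => w; rewrite !ffunE; case: eqP => // ->.
Qed.

(** Inverting [1 - x <= expR (- x)] leaves [0 <= x ^+ 2 * (1 - 2 * x)] to check. *)
Lemma expR_le_quadratic (x : R) : `|x| <= 2^-1 -> expR x <= 1 + x + 2 * x ^+ 2.
Proof.
rewrite ler_norml => /andP[xl xu].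
have h : 1 - x <= expR (- x) by apply: expR_ge1Dx.
have e0 := expR_gt0 x.
have h2 : expR x * (1 - x) <= 1.
  by rewrite -[leRHS](expRxMexpNx_1 x) ler_pM2l.
have h3 : 1 <= (1 + x + 2 * x ^+ 2) * (1 - x) by nra.
have x1 : 0 < 1 - x by lra.
by rewrite -(ler_pM2r x1); apply: le_trans h2 h3.
Qed.

(** The linear term of the quadratic bound sums to zero, which leaves [1 + 2 * c ^+ 2] per term. *)
Lemma sum_expR_centered (c : R) (u : B -> R) : c <= 2^-1 ->
  (forall a, `|u a| <= c) -> \sum_a u a = 0 ->
  \sum_a expR (u a) <= #|B|%:R * expR (2 * c ^+ 2).
Proof.
move=> c2 uc u0.
apply: (@le_trans _ _ (\sum_a (1 + 2 * c ^+ 2 + u a))).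
  apply: ler_sum => a _; apply: le_trans (expR_le_quadratic (u a) _) _.
    exact: le_trans (uc a) c2.
  have : u a ^+ 2 <= c ^+ 2 by rewrite -real_normK ?num_real// lerXn2r ?nnegrE//
    (le_trans _ (uc a)).
  lra.
rewrite big_split /= u0 addr0 sumr_const -[leLHS]mulr_natl.
by rewrite ler_wpM2l // expR_ge1Dx.
Qed.

(* Since g moves s off itself, the value at one point of s can be resampled
   without affecting the terms of the other points. *)
Lemma expR_moment (c : R) (u : B -> B -> R) (g : D -> D) (s : seq D) :
  c <= 2^-1 -> (forall a b, `|u a b| <= c) -> (forall b, \sum_a u a b = 0) ->
  uniq s -> {in s, forall z, g z \notin s} ->
  \sum_(E : {ffun D -> B}) expR (\sum_(z <- s) u (E z) (E (g z))) <=
    #|{ffun D -> B}|%:R * expR (2 * c ^+ 2 * (size s)%:R).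
Proof.
move=> c2 uc u0.
elim: s => [|z s IHs] /=.
  move=> _ _; rewrite mulr0 expR0 mulr1 (eq_bigr (fun=> 1)) ?sumr_const//.
  by move=> E _; rewrite big_nil expR0.
move=> /andP[zs us] gs.
have gz : g z != z by have := gs z (mem_head _ _); rewrite inE negb_or => /andP[].
have {}IHs := IHs us _.
have gs' w : w \in s -> (w != z) && (g w != z) && (g w \notin s).
  move=> ws; have := gs w; rewrite !inE ws orbT negb_or => /(_ isT) /andP[-> ->].
  by rewrite !andbT; apply: contraNneq zs => <-.
have {}IHs : \sum_(E : {ffun D -> B}) expR (\sum_(z <- s) u (E z) (E (g z))) <=
    #|{ffun D -> B}|%:R * expR (2 * c ^+ 2 * (size s)%:R).
  by apply: IHs => w /gs' /andP[].
(* If [B] is empty there is no [E] at all, since [D] contains [z]. *)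
have [B0|B0] := posnP #|B|.
  rewrite big1 ?mulr_ge0 ?expR_ge0//.
  by move=> E _; have := card0_eq B0 (E z); rewrite inE.
have B0' : 0 < #|B|%:R :> R by rewrite ltr0n.
(* Averaging over the value at [z] integrates out the term of [z]: neither [g z] nor any [w] or
   [g w] with [w] in [s] equals [z], so nothing else changes. *)
rewrite -(ler_pM2l B0') -(sum_resample z).
rewrite (eq_bigr (fun E : {ffun D -> B} =>
    expR (\sum_(z <- s) u (E z) (E (g z))) * \sum_a expR (u a (E (g z)))));
    last first.
  move=> E _; rewrite mulr_sumr; apply: eq_bigr => a _.
  rewrite big_cons expRD mulrC !ffunE eqxx (negPf gz); congr (expR _ * _).
  rewrite big_seq [RHS]big_seq; apply: eq_bigr => w /gs' /andP[/andP[wz gwz] _].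
  by rewrite !ffunE (negPf wz) (negPf gwz).
apply: (@le_trans _ _ (\sum_(E : {ffun D -> B}) expR (\sum_(z <- s) u (E z) (E (g z))) *
    (#|B|%:R * expR (2 * c ^+ 2)))).
  apply: ler_sum => E _; rewrite ler_wpM2l ?expR_ge0//.
  exact: sum_expR_centered.
rewrite -mulr_suml [leLHS]mulrC -[leLHS]mulrA ler_pM2l//.
rewrite -(natr1 (size s)) mulrDr mulr1 expRD.
apply: (le_trans (ler_wpM2l (expR_ge0 _) IHs)).
by rewrite le_eqVlt; apply/orP; left; apply/eqP; ring.
Qed.

End ExponentialMoment.

(** * A union bound over all configurations *)

(** Some [w] keeps the sum over [i] within the bound on its mean, and by nonnegativity that sum
    dominates each of its terms. *)
Lemma first_moment_union (R : realType) (I W : finType) (P : pred I)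
    (F : I -> W -> R) (K : R) :
  (0 < #|W|)%N -> 0 <= K -> (forall i w, 0 <= F i w) ->
  (forall i, P i -> \sum_w F i w <= #|W|%:R * K) ->
  exists w, forall i, P i -> F i w <= #|I|%:R * K.
Proof.
move=> W0 K0 F0 FK.
have : \sum_w \sum_(i | P i) F i w <= \sum_(w : W) #|I|%:R * K.
  rewrite exchange_big sumr_const /= -[leRHS]mulr_natl mulrCA.
  apply: (@le_trans _ _ (\sum_(i | P i) #|W|%:R * K)); first exact: ler_sum.
  rewrite sumr_const -[leLHS]mulr_natl ler_wpM2r ?mulr_ge0 ?ler_nat//.
  exact: max_card.
have [w0 _] := card_gt0P W0.
move=> le_sums; have [w wP] : exists w, \sum_(i | P i) F i w <= #|I|%:R * K.
  apply/not_existsP => h; move: le_sums; apply/negP; rewrite -ltNge.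
  apply: ltr_sum => [|w _]; last by rewrite ltNge; apply/negP/h.
  by apply/hasP; exists w0 => //; rewrite mem_index_enum.
exists w => i Pi; apply: le_trans wP; rewrite (bigD1 i)//= lerDl.
exact: sumr_ge0.
Qed.

Section RandomFunction.
Context (R : realType) (A B : finType).

(** The subtracted mean makes the sum over the first output vanish, as the moment bound requires. It
    is also what a uniform first output contributes to a signed sum. *)
Definition centered_sign (sg : B * B -> bool) (a b : B) : R :=
  (-1) ^+ sg (a, b) - (#|B|%:R)^-1 * \sum_c (-1) ^+ sg (c, b).

Context (B0 : (0 < #|B|)%N).

Lemma sum_centered_sign sg b : \sum_a centered_sign sg a b = 0.
Proof.
rewrite big_split /= sumr_const -[X in _ + X]mulr_natl mulrN mulrA mulfV ?mul1r ?subrr//.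
by rewrite pnatr_eq0 -lt0n.
Qed.

Lemma centered_sign_le2 sg a b : `|centered_sign sg a b| <= 2.
Proof.
apply: le_trans (ler_normB _ _) _; rewrite normrX normrN1 expr1n.
have -> : 2 = 1 + 1 :> R by ring.
rewrite lerD2l normrM normfV normr_nat mulrC ler_pdivrMr ?ltr0n// mul1r.
apply: le_trans (ler_norm_sum _ _ _) _.
rewrite (eq_bigr (fun=> 1)) ?sumr_const//.
by move=> c _; rewrite normrX normrN1 expr1n.
Qed.

(** The natural number on the right counts the tuples [(f1, f2, S, T, sg)]; [E] may depend on [l]
    but on none of these. *)
Lemma good_function_exists (l : R) : 0 <= l -> l <= 4^-1 ->
  exists E : {ffun A * A -> B},
  forall (f1 f2 : {ffun A -> A}) (S T : {ffun A -> bool})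
      (sg : {ffun B * B -> bool}),
    (forall x y, S x -> T y -> ~~ (S (f1 x) && T (f2 y))) ->
    expR (l * \sum_(x | S x) \sum_(y | T y)
      centered_sign sg (E (x, y)) (E (f1 x, f2 y))) <=
    ((#|A| ^ #|A|) ^ 2 * (2 ^ #|A|) ^ 2 * 2 ^ (#|B| * #|B|))%:R *
    expR (8 * l ^+ 2 * (#|A| * #|A|)%:R).
Proof.
move=> l0 l4.
pose cfg := ({ffun A -> A} * {ffun A -> A} *
  ({ffun A -> bool} * {ffun A -> bool}) * {ffun B * B -> bool})%type.
pose good (i : cfg) := [forall z : A * A,
  i.1.2.1 z.1 && i.1.2.2 z.2 ==> ~~ (i.1.2.1 (i.1.1.1 z.1) && i.1.2.2 (i.1.1.2 z.2))].
pose F (i : cfg) (E : {ffun A * A -> B}) : R :=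
  expR (l * \sum_(x | i.1.2.1 x) \sum_(y | i.1.2.2 y)
      centered_sign i.2 (E (x, y)) (E (i.1.1.1 x, i.1.1.2 y))).
pose K : R := expR (8 * l ^+ 2 * (#|A| * #|A|)%:R).
have W0 : (0 < #|{ffun A * A -> B}|)%N by rewrite card_ffun expn_gt0 B0.
have FK i : good i -> \sum_E F i E <= #|{ffun A * A -> B}|%:R * K.
  case: i => [[[f1 f2] [S T]] sg]; rewrite /good /F /= => /forallP gd.
  pose C := [pred z : A * A | S z.1 && T z.2].
  (* Centred signs have absolute value at most 2, so the terms are bounded by [2 * l], and
     [l <= 4^-1] brings this below [2^-1]. *)
  have := @expR_moment R (A * A)%type B (2 * l)
    (fun a b => l * centered_sign sg a b) (fun z => (f1 z.1, f2 z.2)) (enum C).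
  have h1 : 2 * l <= 2^-1 by lra.
  have h2 a b : `|l * centered_sign sg a b| <= 2 * l.
    by rewrite normrM (ger0_norm l0) mulrC ler_wpM2r// centered_sign_le2.
  have h3 b : \sum_a l * centered_sign sg a b = 0.
    by rewrite -mulr_sumr sum_centered_sign mulr0.
  have h4 : {in enum C, forall z, (f1 z.1, f2 z.2) \notin enum C}.
    by move=> z; rewrite !mem_enum !inE /= => Cz; have := gd z; rewrite Cz.
  move=> /(_ h1 h2 h3 (enum_uniq _) h4); rewrite -cardE => h.
  apply: (@le_trans _ _ (#|{ffun A * A -> B}|%:R * expR (2 * (2 * l) ^+ 2 * #|C|%:R))).
    apply: le_trans h; rewrite le_eqVlt; apply/orP; left; apply/eqP.
    apply: eq_bigr => E _; rewrite pair_big /= mulr_sumr.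
    rewrite big_enum_cond /=; congr expR; apply: eq_big => [z|[x y] _]//=.
    by rewrite andbT.
  rewrite ler_wpM2l// ler_expR.
  have -> : 2 * (2 * l) ^+ 2 = 8 * l ^+ 2 by ring.
  rewrite ler_wpM2l ?mulr_ge0 ?exprn_ge0// ler_nat -card_prod.
  exact: max_card.
have [E EP] := @first_moment_union R cfg _ good F K W0 (expR_ge0 _)
  (fun i w => expR_ge0 _) FK.
exists E => f1 f2 S T sg gd.
have /EP : good (f1, f2, (S, T), sg).
  by apply/forallP => -[x y] /=; apply/implyP => /andP[Sx Ty]; exact: gd.
rewrite /F /= => /le_trans; apply.
by rewrite !card_prod !card_ffun card_bool card_prod !mulnn.
Qed.

End RandomFunction.

(** * Bilinear forms with bounded weights, and colourings of the tampering maps *)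

(** Negative terms are dropped and the weights of the others are raised to [k]. *)
Lemma weighted_sum_le (R : realType) (I : finType) (P : pred I) (k : R)
    (w g : I -> R) :
  (forall i, 0 <= w i <= k) ->
  \sum_(i | P i) w i * g i <= k * \sum_(i | P i && (0 <= g i)) g i.
Proof.
move=> wk; rewrite mulr_sumr (bigID (fun i => 0 <= g i)) /=.
rewrite -[leRHS]addr0; apply: lerD.
  by apply: ler_sum => i /andP[_ gi]; rewrite ler_wpM2r//; have /andP[] := wk i.
apply: sumr_le0 => i /andP[_]; rewrite -ltNge => gi.
by rewrite mulr_ge0_le0 ?(ltW gi)//; have /andP[] := wk i.
Qed.

Section Bilinear.
Context (R : realType) (A : finType) (k : R) (p q : A -> R) (H : A -> A -> R).
Context (pk : forall x, 0 <= p x <= k) (qk : forall x, 0 <= q x <= k).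

(* A bilinear form on a box is largest at a vertex. *)
Lemma bilinear_le_vertex (P Q : pred A) : 0 <= k ->
  exists S T : {ffun A -> bool},
  [/\ forall x, S x -> P x, forall y, T y -> Q y &
   \sum_(x | P x) \sum_(y | Q y) p x * q y * H x y <=
     k ^+ 2 * \sum_(x | S x) \sum_(y | T y) H x y].
Proof.
move=> k0.
(* [S] is optimal against the weights [q]; [T] is optimal once [p] has been replaced by the vertex
   [S]. *)
pose S := [ffun x => P x && (0 <= \sum_(y | Q y) q y * H x y)].
pose T := [ffun y => Q y && (0 <= \sum_(x | S x) H x y)].
exists S, T; split; [by move=> x; rewrite ffunE => /andP[]
  | by move=> x; rewrite ffunE => /andP[] |].
rewrite (eq_bigr (fun x => p x * \sum_(y | Q y) q y * H x y)); last first.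
  by move=> x _; rewrite mulr_sumr; apply: eq_bigr => y _; rewrite mulrA.
apply: le_trans (weighted_sum_le _ _ _ k _ _ pk) _.
rewrite expr2 -mulrA ler_wpM2l//.
rewrite (eq_bigl (fun x => S x)); last by move=> x; rewrite ffunE.
rewrite exchange_big /= (eq_bigr (fun y => q y * \sum_(x | S x) H x y)); last first.
  by move=> y _; rewrite mulr_sumr.
apply: le_trans (weighted_sum_le _ _ _ k _ _ qk) _.
rewrite [X in _ <= _ * X]exchange_big /= ler_wpM2l// le_eqVlt; apply/orP; left; apply/eqP.
by apply: eq_bigl => y; rewrite ffunE.
Qed.

(** Only the variable whose map has a colouring is split into classes. A vertex set inside one class
    is moved off itself by that map, so the hypothesis on [Z] applies to each class. *)
Lemma bilinear_le_coloured (K : finType) (f1 f2 : A -> A) (Z : R) : 0 <= k ->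
  (forall S T : {ffun A -> bool},
    (forall x y, S x -> T y -> ~~ (S (f1 x) && T (f2 y))) ->
    \sum_(x | S x) \sum_(y | T y) H x y <= Z) ->
  (exists c : A -> K, forall x, c (f1 x) != c x) \/
    (exists c : A -> K, forall x, c (f2 x) != c x) ->
  \sum_x \sum_y p x * q y * H x y <= #|K|%:R * (k ^+ 2 * Z).
Proof.
move=> k0 HZ [] [c cP].
- rewrite (partition_big c xpredT)//= mulr_natl -sumr_const.
  apply: ler_sum => i _.
  have [S [T [SP TP le]]] := bilinear_le_vertex (fun x => c x == i) xpredT k0.
  apply: le_trans le _; rewrite ler_wpM2l ?exprn_ge0//; apply: HZ => x y Sx Ty.
  rewrite negb_and; apply/orP; left; apply/negP => /SP /eqP h.
  by have /eqP := SP x Sx; rewrite -h; apply/eqP; rewrite eq_sym.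
- rewrite exchange_big (partition_big c xpredT)//= mulr_natl -sumr_const.
  apply: ler_sum => i _; rewrite exchange_big /=.
  have [S [T [SP TP le]]] := bilinear_le_vertex xpredT (fun x => c x == i) k0.
  apply: le_trans le _; rewrite ler_wpM2l ?exprn_ge0//; apply: HZ => x y Sx Ty.
  rewrite negb_and; apply/orP; right; apply/negP => /TP /eqP h.
  by have /eqP := TP y Ty; rewrite -h; apply/eqP; rewrite eq_sym.
Qed.

End Bilinear.

(* Colour x by a coordinate where x and f x differ, together with its value. *)
Lemma no_fixed_point_colouring (n : nat) (f : bits n -> bits n) :
  no_fixed_point f -> exists c : bits n -> 'I_n * bool, forall x, c (f x) != c x.
Proof.
move=> nf.
have h x : exists i, tnth (f x) i != tnth x i.
  apply/existsP; rewrite -[X in is_true X]negbK negb_exists.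
  apply/negP => /forallP fx; apply: (nf x); apply: eq_from_tnth => i.
  by apply/eqP; rewrite -[X in is_true X]negbK; exact: fx.
pose i x := xchoose (h x).
exists (fun x => (i x, tnth x (i x))) => x; apply/eqP => -[ii].
by rewrite ii; apply/eqP; exact: xchooseP (h x).
Qed.

(** * Choice of parameters for random functions on bit strings *)

Lemma card_bits (n : nat) : #|{: bits n}| = (2 ^ n)%N.
Proof. by rewrite card_tuple card_bool. Qed.

Lemma natr2X_le_expR (R : realType) (n : nat) : (2 ^ n)%:R <= expR n%:R :> R.
Proof.
rewrite -[n%:R]mulr1 expRM_natl natrX lerXn2r ?nnegrE ?expR_ge0//.
exact: (expR_ge1Dx 1).
Qed.

(** The number of configurations for inputs [bits n] and outputs [bits m]. The maps take
    [2 * n * 2 ^ n] bits and the sets [2 * 2 ^ n]; [2 * m <= n] keeps the sign tables within [2 ^ n]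
    bits. *)
Lemma config_count_le (n m : nat) : (0 < n)%N -> (2 * m <= n)%N ->
  exists2 e, (((2 ^ n) ^ (2 ^ n)) ^ 2 * (2 ^ (2 ^ n)) ^ 2 * 2 ^ (2 ^ m * 2 ^ m) = 2 ^ e)%N
    & (e <= 5 * n * 2 ^ n)%N.
Proof.
move=> n0 mn; exists (n * 2 ^ n * 2 + 2 ^ n * 2 + 2 ^ m * 2 ^ m)%N.
  by rewrite !expnD !expnM.
have : (2 ^ m * 2 ^ m <= 2 ^ n)%N by rewrite -expnD addnn -mul2n leq_exp2l.
move: (2 ^ m * 2 ^ m)%N (2 ^ n)%N => M N MN.
have h : (N <= n * N)%N by rewrite leq_pmull.
have -> : (5 * n * N = n * N * 2 + n * N * 2 + n * N)%N by ring.
rewrite leq_add ?leq_add ?leq_mul//; exact: leq_trans MN h.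
Qed.

(* With x = 2^(n/16): N = x^16, the sources have weights at most x^-15, and
   l = x^-4 gives Z <= 5 n x^20 + 8 x^28. *)
Lemma random_extractor (R : realType) (n m : nat) (x : R) :
  (0 < n)%N -> (2 * m <= n)%N -> x ^+ 16 = (2 ^ n)%:R -> 16 * n%:R ^+ 2 <= x ->
  exists E : bits n * bits n -> bits m,
  forall (f1 f2 : bits n -> bits n) (p q : bits n -> R) (sg : {ffun bits m * bits m -> bool}),
    no_fixed_point f1 \/ no_fixed_point f2 ->
    (forall u, 0 <= p u <= x ^- 15) -> (forall u, 0 <= q u <= x ^- 15) ->
    \sum_u \sum_v p u * q v * centered_sign R (bits m) sg (E (u, v)) (E (f1 u, f2 v)) <= 2 * x^-1.
Proof.
move=> n0 mn xn nx.
have n1 : 1 <= n%:R :> R by rewrite ler1n.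
have x0 : 0 < x by nra.
pose y := x^-1; have y0 : 0 < y by rewrite invr_gt0.
have yx : y * x = 1 by rewrite mulVf// gt_eqF.
have yn : 16 * n%:R ^+ 2 * y <= 1 by rewrite -[leRHS]yx [leRHS]mulrC ler_wpM2r// ltW.
have y1 : y <= 16^-1 by nra.
have y4l : y ^+ 4 <= 4^-1.
  apply: le_trans (_ : y <= _); last lra.
  by rewrite exprS ger_pMr// exprn_ile1 ?ltW//; lra.
have Bpos : (0 < #|{: bits m}|)%N by rewrite card_bits expn_gt0.
have [E EP] := @good_function_exists R {: bits n} {: bits m} Bpos (y ^+ 4) (exprn_ge0 _ (ltW y0)) y4l.
exists E => f1 f2 p q sg nf pk qk.
pose Z := 5 * n%:R * x ^+ 20 + 8 * x ^+ 28.
have HZ (S T : {ffun bits n -> bool}) :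
    (forall x y, S x -> T y -> ~~ (S (f1 x) && T (f2 y))) ->
    \sum_(u | S u) \sum_(v | T v) centered_sign R (bits m) sg (E (u, v)) (E (f1 u, f2 v)) <= Z.
  move=> gd; have := EP (finfun f1) (finfun f2) S T sg.
  have gd' u v : S u -> T v -> ~~ (S (finfun f1 u) && T (finfun f2 v)).
    by rewrite !ffunE; exact: gd.
  move=> /(_ gd'); rewrite !card_bits.
  have [e -> eN] := config_count_le _ _ n0 mn.
  set W := \sum_(u | _) _; set W' := \sum_(u | _) _.
  have -> : W = W'.
    by apply: eq_bigr => u _; apply: eq_bigr => v _; rewrite !ffunE.
  move=> h.
  (* Take logarithms, the count [2 ^ e] being at most [expR e]. *)
  have {}h : y ^+ 4 * W' <= e%:R + 8 * (y ^+ 4) ^+ 2 * (2 ^ n * 2 ^ n)%:R.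
    rewrite -ler_expR expRD; apply: le_trans h _.
    by rewrite ler_wpM2r ?expR_ge0// natr2X_le_expR.
  have eN' : e%:R <= 5 * n%:R * x ^+ 16.
    by rewrite xn -!natrM ler_nat.
  rewrite -(@ler_pM2l _ (y ^+ 4)) ?exprn_gt0//; apply: le_trans h _.
  rewrite natrM -xn /Z; apply: le_trans (lerD eN' (lexx _)) _.
  rewrite le_eqVlt; apply/orP; left; apply/eqP; rewrite /y; field.
  by rewrite gt_eqF.
have ck0 : 0 <= x ^- 15 by rewrite invr_ge0 exprn_ge0// ltW.
have := @bilinear_le_coloured R _ (x ^- 15) p q _ pk qk ('I_n * bool)%type f1 f2 Z ck0 HZ.
have cc : (exists c : bits n -> 'I_n * bool, forall x, c (f1 x) != c x) \/
    (exists c : bits n -> 'I_n * bool, forall x, c (f2 x) != c x).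
  by case: nf => /no_fixed_point_colouring; [left|right].
move=> /(_ cc) /le_trans; apply.
rewrite card_prod card_ord card_bool natrM.
have -> : x ^- 15 ^+ 2 * Z = 5 * n%:R * y ^+ 10 + 8 * y ^+ 2.
  by rewrite /Z /y; field; rewrite gt_eqF.
have y10 : y ^+ 10 <= y ^+ 2.
  by rewrite (exprD y 2 8) ger_pMr ?exprn_gt0// exprn_ile1 ?ltW//; lra.
have : 5 * n%:R * y ^+ 10 + 8 * y ^+ 2 <= 13 * n%:R * y ^+ 2 by nra.
(* The [2 * n] colours give [26 * n ^+ 2 * y ^+ 2], which is at most [2 * y] because
   [16 * n ^+ 2 * y <= 1]. *)
move=> h; apply: (@le_trans _ _ (n%:R * 2 * (13 * n%:R * y ^+ 2))).
  by rewrite ler_wpM2l//; nra.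
have : 13 * n%:R ^+ 2 * y * y <= y by rewrite ger_pMl//; nra.
rewrite -/y; lra.
Qed.

(** * Laws of finite-valued random variables *)

(** Coordinates are measurable, and a singleton is a finite intersection of coordinate events. *)
Lemma measurable_set1_bits (n : nat) (a : bits n) : measurable [set a].
Proof.
have -> : [set a] = \bigcap_(i in [set: 'I_n])
    ((fun t : bits n => tnth t i) @^-1` [set tnth a i]).
  apply/seteqP; split => [t -> //|t /= h].
  by apply: eq_from_tnth => i; exact: h.
apply: fin_bigcap_measurable => // i _.
rewrite -[X in measurable X]setTI; exact: measurable_tnth.
Qed.

Section FiniteLaw.
Context (d : measure_display) (T : measurableType d) (R : realType)
  (P : probability T R).

Lemma prob_eq_ge0 (A : finType) (X : T -> A) (a : A) : 0 <= prob_eq P X a.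
Proof. exact: fine_ge0. Qed.

(** Finite additivity by induction on the list; measurability is carried along because additivity on
    a disjoint union asks for it. *)
Lemma prob_preimage_seq (A : finType) (X : T -> A) (s : seq A) :
  (forall a, measurable (X @^-1` [set a])) -> uniq s ->
  measurable (X @^-1` [set` s]) /\
  fine (P (X @^-1` [set` s])) = \sum_(a <- s) prob_eq P X a.
Proof.
move=> mX; elim: s => [|a s IHs] /=.
  rewrite (_ : _ @^-1` _ = set0) ?big_nil ?measure0//.
  by apply/seteqP; split => t.
move=> /andP[as_ us]; have [ms Ps] := IHs us.
have -> : X @^-1` [set` a :: s] = X @^-1` [set a] `|` X @^-1` [set` s].
  apply/seteqP; split => t /=; rewrite inE.
    by move=> /orP[/eqP->|]; [left|right].
  by move=> [->|->]; rewrite ?eqxx ?orbT.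
split; first exact: measurableU.
rewrite measureU//; last first.
  by apply/seteqP; split => // t [/= ->]; rewrite (negPf as_).
by rewrite fineD ?fin_num_measure// Ps big_cons.
Qed.

Lemma prob_eq_comp (A B : finType) (X : T -> A) (phi : A -> B) (b : B) :
  (forall a, measurable (X @^-1` [set a])) ->
  prob_eq P (fun t => phi (X t)) b = \sum_(a | phi a == b) prob_eq P X a.
Proof.
move=> mX; rewrite -big_filter.
have [_ <-] := prob_preimage_seq _ X [seq a <- index_enum A | phi a == b] mX
  (filter_uniq _ (index_enum_uniq _)).
congr (fine (P _)); apply/seteqP; split => t /=; rewrite mem_filter mem_index_enum andbT.
  by move=> ->; rewrite eqxx.
by move=> /eqP.
Qed.

(** Change of variables: both sides are the expectation of [F (phi X)]. *)
Lemma sum_prob_eq_comp (A B : finType) (X : T -> A) (phi : A -> B) (F : B -> R) :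
  (forall a, measurable (X @^-1` [set a])) ->
  \sum_b F b * prob_eq P (fun t => phi (X t)) b = \sum_a F (phi a) * prob_eq P X a.
Proof.
move=> mX; rewrite [RHS](partition_big phi xpredT)//=.
apply: eq_bigr => b _; rewrite (prob_eq_comp _ _ X phi b mX) mulr_sumr.
by apply: eq_bigr => a /eqP->.
Qed.

Lemma measurable_preimage_pair (A B : finType) (X : T -> A) (Y : T -> B) :
  (forall a, measurable (X @^-1` [set a])) ->
  (forall b, measurable (Y @^-1` [set b])) ->
  forall c, measurable ((fun t => (X t, Y t)) @^-1` [set c]).
Proof.
move=> mX mY [a b].
have -> : (fun t => (X t, Y t)) @^-1` [set (a, b)] =
    X @^-1` [set a] `&` Y @^-1` [set b].
  by apply/seteqP; split => t /= [-> ->].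
exact: measurableI.
Qed.

Lemma is_source_prob_le (n : nat) (k : R) (X : T -> bits n) (a : bits n) :
  is_source P k X -> prob_eq P X a <= 2 `^ (- k).
Proof.
move=> Xk; have : (k%:E <= if prob_eq P X a == 0%R then +oo
    else (log2 (prob_eq P X a)^-1)%:E)%E.
  by apply: le_trans Xk _; exact: bigmin_le.
(* A point of probability 0 contributes [+oo], which carries no information, but its bound is
   trivial. *)
case: eqP => [-> _|/eqP p0]; first exact: powR_ge0.
have {}p0 : 0 < prob_eq P X a by rewrite lt_neqAle eq_sym p0 prob_eq_ge0.
have l2 : 0 < ln 2 :> R by rewrite ln_gt0// ltr1n.
rewrite lee_fin /log2 lnV ?posrE// ler_pdivlMr// => h.
by rewrite /powR pnatr_eq0 /= -ler_ln ?posrE ?expR_gt0// expRK; lra.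
Qed.

(** Let [sg] record where the difference of the two laws is negative: the absolute values become
    signed sums, that is, expectations over the sources. *)
Lemma stat_dist_nm (n m : nat) (X1 X2 : {RV P >-> bits n}) (U : {RV P >-> bits m})
    (E : bits n * bits n -> bits m) (f1 f2 : bits n -> bits n) :
  independent P X1 X2 -> uniform P U -> independent P U (fun t => (X1 t, X2 t)) ->
  exists sg : {ffun bits m * bits m -> bool},
  stat_dist P (fun t => (E (X1 t, X2 t), E (f1 (X1 t), f2 (X2 t))))
    (fun t => (U t, E (f1 (X1 t), f2 (X2 t)))) =
  2^-1 * \sum_u \sum_v prob_eq P X1 u * prob_eq P X2 v *
    centered_sign R (bits m) sg (E (u, v)) (E (f1 u, f2 v)).
Proof.
move=> indX unifU indU; rewrite /stat_dist.
set L := (fun t => (E (X1 t, X2 t), _)); set L' := (fun t => (U t, _)).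
pose sg := [ffun c => prob_eq P L c - prob_eq P L' c < 0].
exists sg; congr (_ * _).
have mX1 a : measurable (X1 @^-1` [set a]).
  by apply: measurable_funPTI; exact: measurable_set1_bits.
have mX2 a : measurable (X2 @^-1` [set a]).
  by apply: measurable_funPTI; exact: measurable_set1_bits.
have mU a : measurable (U @^-1` [set a]).
  by apply: measurable_funPTI; exact: measurable_set1_bits.
have mX := measurable_preimage_pair _ _ _ _ mX1 mX2.
have mUX := measurable_preimage_pair _ _ _ _ mU mX.
have -> : \sum_c `|prob_eq P L c - prob_eq P L' c| =
    \sum_c (-1) ^+ sg c * prob_eq P L c - \sum_c (-1) ^+ sg c * prob_eq P L' c.
  by rewrite -sumrB; apply: eq_bigr => c _; rewrite -mulrBr ffunE -normrEsign.
have -> : \sum_c (-1) ^+ sg c * prob_eq P L c = \sum_(z : bits n * bits n)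
    (-1) ^+ sg (E z, E (f1 z.1, f2 z.2)) * (prob_eq P X1 z.1 * prob_eq P X2 z.2).
  rewrite (sum_prob_eq_comp _ _ (fun t => (X1 t, X2 t))
    (fun z => (E z, E (f1 z.1, f2 z.2))) (fun c => (-1) ^+ sg c) mX).
  by apply: eq_bigr => -[x y] _; rewrite indX.
(* As [U] is uniform and independent of the sources, it averages the sign over the first output,
   which yields the centring term. *)
have -> : \sum_c (-1) ^+ sg c * prob_eq P L' c = \sum_(z : bits n * bits n)
    \sum_u (-1) ^+ sg (u, E (f1 z.1, f2 z.2)) * (#|{: bits m}|%:R^-1 *
      (prob_eq P X1 z.1 * prob_eq P X2 z.2)).
  rewrite (sum_prob_eq_comp _ _ (fun t => (U t, (X1 t, X2 t)))
    (fun w => (w.1, E (f1 w.2.1, f2 w.2.2))) (fun c => (-1) ^+ sg c) mUX).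
  rewrite exchange_big pair_big /=.
  by apply: eq_bigr => -[u [x y]] _; rewrite indU indX unifU.
rewrite [RHS]pair_big -sumrB; apply: eq_bigr => -[x y] _ /=.
by rewrite -mulr_suml /centered_sign; ring.
Qed.

End FiniteLaw.

(** * The extractor in terms of min-entropy, and its asymptotics *)

Lemma random_nm_extractor (R : realType) (n m : nat) :
  (0 < n)%N -> (2 * m <= n)%N -> 16 * n%:R ^+ 2 <= 2 `^ (n%:R / 16) :> R ->
  exists nmExt : bits n -> bits n -> bits m,
    nm_two_source_extractor ((1 - 16^-1) * n%:R) (2 `^ (- (n%:R / 16)) : R) nmExt.
Proof.
move=> n0 mn; set x : R := 2 `^ (n%:R / 16) => nx.
have xX i : x ^+ i = 2 `^ (n%:R / 16 * i%:R).
  by rewrite powRrM powR_mulrn// powR_ge0.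
have x16 : x ^+ 16 = (2 ^ n)%:R.
  by rewrite xX divfK ?pnatr_eq0// powR_mulrn// natrX.
have [E EP] := random_extractor R n m x n0 mn x16 nx.
exists (fun u v => E (u, v)) => d T P X1 X2 U f1 f2 s1 s2 indX unifU indU nf.
have [sg ->] := stat_dist_nm _ _ _ P _ _ X1 X2 U E f1 f2 indX unifU indU.
(* The factor [2^-1] of the statistical distance absorbs the 2 of the bound [2 * x^-1]; min-entropy
   [(1 - 16^-1) * n] gives weights at most [x ^- 15]. *)
rewrite powRN -/x -[leRHS]mul1r -[1 in leRHS](@mulVf _ 2) ?pnatr_eq0// -mulrA.
rewrite ler_pM2l ?invr_gt0//; apply: EP => // u; rewrite prob_eq_ge0 /=.
  have := is_source_prob_le _ _ _ P _ _ _ u s1; rewrite powRN.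
  by rewrite xX (_ : n%:R / 16 * 15 = (1 - 16^-1) * n%:R)//; field.
have := is_source_prob_le _ _ _ P _ _ _ u s2; rewrite powRN.
by rewrite xX (_ : n%:R / 16 * 15 = (1 - 16^-1) * n%:R)//; field.
Qed.

Lemma near_sqr_le_powR (R : realType) :
  \forall n \near \oo, 16 * n%:R ^+ 2 <= 2 `^ (n%:R / 16) :> R.
Proof.
have l2 : 0 < ln 2 :> R by rewrite ln_gt0// ltr1n.
have [c c0 cE] : exists2 c : R, 0 < c & ln 2 / 16 = c.
  by exists (ln 2 / 16) => //; rewrite divr_gt0.
near=> n.
(* The cubic term of the exponential series gives [expR (n * c) >= (n * c) ^+ 3 / 6], which is at
   least [16 * n ^+ 2] once [n * c ^+ 3 >= 96 = 16 * 6]. *)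
have nc : 96 / c ^+ 3 <= n%:R by near: n; exact: nbhs_infty_ger.
rewrite /powR pnatr_eq0 /= mulrAC -mulrA cE.
have nc0 : 0 <= n%:R * c by rewrite mulr_ge0// ltW.
apply: le_trans (expR_ge1Dxn 2 nc0).
rewrite ler_pdivrMr ?exprn_gt0// in nc.
have := ler_wpM2r (sqr_ge0 (n%:R : R)) nc.
rewrite (_ : 3`! = 6)%N//; lra.
Unshelve. all: by end_near. Qed.

Theorem theorem6p9 (R : realType) :
  exists gamma : R, 0 < gamma /\ gamma < 1 /\
  exists (m : nat -> nat) (e : nat -> R),
    isOmega (fun n => (m n)%:R : R) (fun n => n%:R) /\
    isOmega e (fun n => n%:R * log2 (log2 n%:R) / log2 n%:R) /\
    forall n : nat, exists nmExt : bits n -> bits n -> bits (m n),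
      nm_two_source_extractor ((1 - gamma) * n%:R) (2 `^ (- e n)) nmExt.
Proof.
pose good n := (0 < n)%N && (16 * n%:R ^+ 2 <= 2 `^ (n%:R / 16) :> R).
have near_good : \forall n \near \oo, good n /\ (1 < n)%N.
  near=> n; have n1 : (1 < n)%N by near: n; exact: nbhs_infty_ge.
  by split => //; rewrite /good (ltnW n1); near: n; exact: near_sqr_le_powR.
exists 16^-1; split; [lra|split; [lra|]].
(* For the finitely many other [n] the output is the empty tuple and the allowed error is 1; the two
   laws then coincide. *)
exists (fun n => if good n then n./2 else 0%N), (fun n => if good n then n%:R / 16 else 0).
split; [|split].
- exists 4^-1; first lra.
  apply: filterS near_good => n [-> n1].
  rewrite ler_pdivrMl// -natrM ler_nat.
  have h : (n <= 1 + n./2 * 2)%N.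
    by rewrite -{1}(odd_double_half n) muln2 leq_add2r leq_b1.
  by have := half_gt0 n; rewrite n1; move: h; lia.
- have l2 : 0 < ln 2 :> R by rewrite ln_gt0// ltr1n.
  exists (ln 2 / 16); first by rewrite divr_gt0.
  apply: filterS near_good => n [-> n1].
  have : 0 < log2 n%:R :> R by rewrite divr_gt0// ln_gt0// ltr1n.
  move: (log2 n%:R) => y y0.
  (* The constant [ln 2 / 16] cancels the [ln 2] of the outer logarithm. The exponent [n / 16] is
     linear, so [ln y <= y] suffices. *)
  rewrite [leLHS](_ : _ = n%:R / 16 * (ln y / y)); last first.
    by rewrite /log2; field; rewrite !gt_eqF.
  by rewrite ler_piMr ?divr_ge0// ler_pdivrMr// mul1r ltW// ln_sublinear.
- move=> n; case: ifP => [/andP[n0 nx]|_].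
    by apply: random_nm_extractor => //; rewrite mul2n -{2}(odd_double_half n) leq_addl.
  exists (fun _ _ => [tuple]) => d T P X1 X2 U f1 f2 *.
  rewrite (_ : stat_dist _ _ _ = 0) ?powR_ge0// /stat_dist big1 ?mulr0// => a _.
  rewrite (_ : (fun t => ([tuple], _)) = (fun t => (U t, [tuple]))) ?subrr ?normr0//.
  by apply/funext => t; rewrite (tuple0 (U t)).
Unshelve. all: by end_near. Qed.
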